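(* Let $\Omega=\Omega(t,x,y)$ and $\Psi=\Psi(t,x,y)$ be sufficiently smooth real-valued functions with $\Omega=\Delta\Psi$ that solve the 2D Euler equation $$\partial_t\Omega+\{\Psi,\Omega\}=0 .$$ For a pair of potentials $(\Omega,\Psi)$ consider the linear system for an unknown complex-valued function $p=p(t,x,y)$ (the Lax pair at $\lambda=0$) $$\{\Omega,p\}=0,\qquad \partial_t p+\{\Psi,p\}=0. \tag{S}$$ Let $f=f(t,x,y)$ be any fixed solution of the system (S) at $(\Omega,\Psi)$, and let $p$ be any solution of (S) at $(\Omega,\Psi)$, where $\Omega_x$ and $f$ are nowhere zero on the domain considered. Define the gauge transform $$\tilde p=G_f p=\frac{1}{\Omega_x}\Big[p_x-(\partial_x\ln f)\,p\Big],\qquad \partial_x \ln f:=\frac{f_x}{f},$$ and the transforms of the potentials $$\tilde\Psi=\Psi+F,\qquad \tilde\Omega=\Omega+\Delta F,$$ where $F=F(t,x,y)$ is a sufficiently smooth real-valued function subject to the constraints $$\{\Omega,\Delta F\}=0,\qquad \{\Omega+\Delta F,\,F\}=0 .$$ Then $\tilde p$ solves the system (S) at $(\tilde\Omega,\tilde\Psi)$, that is, $$\{\tilde\Omega,\tilde p\}=0,\qquad \partial_t\tilde p+\{\tilde\Psi,\tilde p\}=0 .$$ (It is in this sense that $p\mapsto\tilde p$, $(\Omega,\Psi)\mapsto(\tilde\Omega,\tilde\Psi)$ is called a Darboux transformation for the 2D Euler equation and its Lax pair.)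
   Context: The independent variables are time $t$ and planar space variables $(x,y)$. Subscripts $t,x,y$ denote partial derivatives, $\Delta=\partial_x^2+\partial_y^2$ is the spatial Laplacian, and the bracket is $\{g,h\}=(\partial_x g)(\partial_y h)-(\partial_y g)(\partial_x h)$. Here $\Omega$ is the vorticity and $\Psi$ the stream function of a two-dimensional incompressible inviscid flow with velocity $(-\partial_y\Psi,\partial_x\Psi)$. The Lax pair of the 2D Euler equation is $\{\Omega,\varphi\}=\lambda\varphi$, $\partial_t\varphi+\{\Psi,\varphi\}=0$, with $\lambda$ a complex constant and $\varphi$ a complex-valued function; the theorem concerns the case $\lambda=0$.
   Formalization: The claim fails as stated (Ω=x, Ψ=x³/6, f=1, p=x², F=y−x³/6 gives −2 in the second equation), so it is additionally assumed that the spatial gradient of Ω+ΔF vanishes identically on no nonempty open subset of the domain. *)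

(* Defs.v *)
From Stdlib Require Import Reals.
From Coquelicot Require Import Coquelicot.
Local Open Scope R_scope.

(* Points of R * R * R are (t, x, y). *)
Definition dt (g : R * R * R -> R) (P : R * R * R) : R :=
  let '(t, x, y) := P in Derive (fun s => g (s, x, y)) t.

Definition dx (g : R * R * R -> R) (P : R * R * R) : R :=
  let '(t, x, y) := P in Derive (fun s => g (t, s, y)) x.

Definition dy (g : R * R * R -> R) (P : R * R * R) : R :=
  let '(t, x, y) := P in Derive (fun s => g (t, x, s)) y.

Definition laplacian (g : R * R * R -> R) (P : R * R * R) : R :=
  dx (dx g) P + dy (dy g) P.

Definition bracket (g h : R * R * R -> R) (P : R * R * R) : R :=
  dx g P * dy h P - dy g P * dx h P.

(* Since [Derive] is total (junk value where there is no derivative), existence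
   of the partial derivatives is part of the smoothness class. *)
Definition has_partials (g : R * R * R -> R) (P : R * R * R) : Prop :=
  let '(t, x, y) := P in
  ex_derive (fun s => g (s, x, y)) t /\
  ex_derive (fun s => g (t, s, y)) x /\
  ex_derive (fun s => g (t, x, s)) y.

Fixpoint Ck (k : nat) (D : R * R * R -> Prop) (g : R * R * R -> R) : Prop :=
  (forall P, D P -> continuous g P) /\
  match k with
  | O => True
  | S j => (forall P, D P -> has_partials g P) /\
           Ck j D (dt g) /\ Ck j D (dx g) /\ Ck j D (dy g)
  end.

Definition re_part (p : R * R * R -> C) (P : R * R * R) : R := Re (p P).
Definition im_part (p : R * R * R -> C) (P : R * R * R) : R := Im (p P).

Definition CkC (k : nat) (D : R * R * R -> Prop) (p : R * R * R -> C) : Prop :=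
  Ck k D (re_part p) /\ Ck k D (im_part p).

Definition dtC (p : R * R * R -> C) (P : R * R * R) : C :=
  (dt (re_part p) P, dt (im_part p) P).

Definition dxC (p : R * R * R -> C) (P : R * R * R) : C :=
  (dx (re_part p) P, dx (im_part p) P).

Definition dyC (p : R * R * R -> C) (P : R * R * R) : C :=
  (dy (re_part p) P, dy (im_part p) P).

Definition bracketC (g : R * R * R -> R) (p : R * R * R -> C)
    (P : R * R * R) : C :=
  (RtoC (dx g P) * dyC p P - RtoC (dy g P) * dxC p P)%C.

Definition euler_solution (D : R * R * R -> Prop)
    (Omega Psi : R * R * R -> R) : Prop :=
  forall P, D P ->
    Omega P = laplacian Psi P /\ dt Omega P + bracket Psi Omega P = 0.

(* Classical solutions of the Lax pair at lambda = 0.  The C^1 clause keeps the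
   equations from being satisfied by junk values of [Derive]. *)
Definition lax_solution (D : R * R * R -> Prop)
    (Omega Psi : R * R * R -> R) (p : R * R * R -> C) : Prop :=
  CkC 1 D p /\
  forall P, D P ->
    bracketC Omega p P = RtoC 0 /\
    (dtC p P + bracketC Psi p P)%C = RtoC 0.

Definition dx_ln (f : R * R * R -> C) (P : R * R * R) : C :=
  (dxC f P / f P)%C.

Definition gauge (Omega : R * R * R -> R) (f p : R * R * R -> C)
    (P : R * R * R) : C :=
  (/ RtoC (dx Omega P) * (dxC p P - dx_ln f P * p P))%C.

Definition new_Psi (Psi F : R * R * R -> R) (P : R * R * R) : R :=
  Psi P + F P.

Definition new_Omega (Omega F : R * R * R -> R) (P : R * R * R) : R :=
  Omega P + laplacian F P.

(* The spatial gradient of [Omega] vanishes identically on no nonempty open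
   subset of [D].  The Darboux transformation needs this of the transformed
   vorticity: where Omega + laplacian F is spatially constant, the constraint
   {Omega + laplacian F, F} = 0 is void and leaves {F, Omega} arbitrary.
   Example: Omega = x, Psi = x^3/6, f = 1, p = x^2, F = y - x^3/6 meet all the
   other requirements of the theorem, the new potentials are 0 and y, the
   gauge transform of p is 2x, and {y, 2x} = -2. *)
Definition nondegenerate (D : R * R * R -> Prop)
    (Omega : R * R * R -> R) : Prop :=
  forall U : R * R * R -> Prop,
    open U -> (forall P, U P -> D P) -> (exists P, U P) ->
    exists P, U P /\ (dx Omega P <> 0 \/ dy Omega P <> 0).

(* Main.v *)
Require Import Defs.
From Stdlib Require Import Reals Lra.
From Coquelicot Require Import Coquelicot.
Local Open Scope R_scope.

(** Let W be the vorticity Omega.  The first Lax equation and W_x <> 0 give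
    grad p = a grad W with a = p_x / W_x.  Substituting this in the second one
    gives p_t = - a {Psi, W}, which is a W_t by the Euler equation.  Hence
    dp = a dW in all three variables: up to smoothness, a solution of the Lax
    pair at lambda = 0 is locally a function of W alone, and conversely every
    function of W solves it, because W itself does.

    Functions of W, in the sense dg /\ dW = 0, are stable under the ring
    operations and inverses.  They are also stable under g |-> g_x / W_x,
    which is differentiation with respect to W: if dg = a dW, equality of
    mixed partials gives 0 = d(dg) = da /\ dW ([function_of_derivative]).
    The gauge transform

       p_x / W_x - ((f_x / W_x) / f) p

    is built from p and f with these operations only, so it is again a function
    of W ([gauge_parts_function_of]).  Everything is done on real and imaginary
    parts, which separately satisfy the Lax pair since its coefficients are real.

    It remains to see that functions of W solve the Lax pair at the new
    potentials ([function_of_lax]).  The constraint {W, laplacian F} = 0 gives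
    the first equation.  The second one needs {W, F} = 0.  Writing
    grad (laplacian F) = g grad W, the other constraint reads
    (1 + g) {W, F} = 0, and W + laplacian F has spatial gradient (1 + g) grad W.
    On the open set where {W, F} <> 0 this gradient would vanish identically,
    so nondegeneracy makes that set empty ([bracket_zero_of_nondegenerate]). *)

(** * Partial derivatives along the three axes *)

Local Notation point := (R * R * R)%type (only parsing).

(** Indexing the partial derivatives by an axis lets the condition
    dg /\ dW = 0 and the calculus rules be stated once for t, x and y. *)
Inductive axis := axis_t | axis_x | axis_y.

Definition partial (i : axis) : (point -> R) -> point -> R :=
  match i with axis_t => dt | axis_x => dx | axis_y => dy end.

Definition coord (i : axis) (P : point) : R :=
  let '(t, x, y) := P in
  match i with axis_t => t | axis_x => x | axis_y => y end.

Definition along (i : axis) (P : point) (s : R) : point :=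
  let '(t, x, y) := P in
  match i with
  | axis_t => (s, x, y) | axis_x => (t, s, y) | axis_y => (t, x, s)
  end.

Definition is_partial (i : axis) (g : point -> R) (P : point) (l : R) : Prop :=
  is_derive (fun s => g (along i P s)) (coord i P) l.

Lemma along_coord i P : along i P (coord i P) = P.
Proof. now destruct P as [[t x] y], i. Qed.

Lemma partial_unique i g P l : is_partial i g P l -> partial i g P = l.
Proof.
  unfold is_partial; intros H; apply is_derive_unique in H; revert H.
  now destruct P as [[t x] y], i.
Qed.

Lemma is_partial_plus i g h P a b :
  is_partial i g P a -> is_partial i h P b ->
  is_partial i (fun Q => g Q + h Q) P (a + b).
Proof. intros Hg Hh; exact (is_derive_plus _ _ _ _ _ Hg Hh). Qed.

Lemma is_partial_minus i g h P a b :
  is_partial i g P a -> is_partial i h P b ->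
  is_partial i (fun Q => g Q - h Q) P (a - b).
Proof. intros Hg Hh; exact (is_derive_minus _ _ _ _ _ Hg Hh). Qed.

Lemma is_partial_mult i g h P a b :
  is_partial i g P a -> is_partial i h P b ->
  is_partial i (fun Q => g Q * h Q) P (a * h P + g P * b).
Proof.
  intros Hg Hh.
  pose proof (is_derive_mult _ _ _ _ _ Hg Hh Rmult_comm) as H.
  cbv beta in H; now rewrite along_coord in H.
Qed.

Lemma is_partial_inv i g P a :
  is_partial i g P a -> g P <> 0 ->
  is_partial i (fun Q => / g Q) P (- a / g P ^ 2).
Proof.
  intros Hg H0.
  assert (H1 : g (along i P (coord i P)) <> 0) by now rewrite along_coord.
  pose proof (is_derive_inv _ _ _ Hg H1) as H.
  cbv beta in H; now rewrite along_coord in H.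
Qed.

(** * Calculus of continuously differentiable functions *)

(** This is [Ck 1], with the three derivatives gathered under one index. *)
Definition C1 (D : point -> Prop) (g : point -> R) : Prop :=
  (forall P, D P -> continuous g P) /\
  (forall i P, D P ->
     is_partial i g P (partial i g P) /\ continuous (partial i g) P).

Lemma has_partials_correct g P i :
  has_partials g P -> is_partial i g P (partial i g P).
Proof.
  destruct P as [[t x] y]; intros [Ht [Hx Hy]].
  destruct i; now apply Derive_correct.
Qed.

Lemma is_partial_has_partials g P :
  (forall i, is_partial i g P (partial i g P)) -> has_partials g P.
Proof.
  destruct P as [[t x] y]; intros H; repeat split; eexists;
    [exact (H axis_t) | exact (H axis_x) | exact (H axis_y)].
Qed.

Lemma Ck_partial k D g i : Ck (S k) D g -> Ck k D (partial i g).
Proof. now intros [_ [_ [Ht [Hx Hy]]]]; destruct i. Qed.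

Lemma Ck_C1 k D g : Ck (S k) D g -> C1 D g.
Proof.
  intros Hg; split; [exact (proj1 Hg)|].
  intros i P HP; split.
  - apply has_partials_correct, (proj1 (proj2 Hg)), HP.
  - generalize (Ck_partial _ _ _ i Hg); intros H.
    now destruct k; apply (proj1 H).
Qed.

Lemma C1_Ck D g : C1 D g -> Ck 1 D g.
Proof.
  intros [Hc Hd]; split; [exact Hc|]; split; [|split; [|split]].
  - intros P HP; apply is_partial_has_partials; intros i; now apply Hd.
  - split; [intros P HP; exact (proj2 (Hd axis_t P HP)) | exact I].
  - split; [intros P HP; exact (proj2 (Hd axis_x P HP)) | exact I].
  - split; [intros P HP; exact (proj2 (Hd axis_y P HP)) | exact I].
Qed.

Lemma continuous_pair {U V W : UniformSpace} (g : U -> V) (h : U -> W) z :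
  continuous g z -> continuous h z -> continuous (fun u => (g u, h u)) z.
Proof.
  intros Hg Hh; apply (continuous_comp_2 g h pair); trivial.
  apply continuous_ext with (f := fun u => u); [now intros [a b]|].
  apply continuous_id.
Qed.

Lemma continuous_along2 i j P z :
  continuous (fun u : R * R => along i (along j P (snd u)) (fst u)) z.
Proof.
  destruct P as [[t x] y], z as [a b], i, j; simpl;
    repeat apply continuous_pair;
    first [apply continuous_const | apply continuous_fst | apply continuous_snd].
Qed.

Lemma continuous_along i P s : continuous (along i P) s.
Proof.
  destruct P as [[t x] y], i; simpl; repeat apply continuous_pair;
    first [apply continuous_const | apply continuous_id].
Qed.

(** An identity valid on an open set restricts to a neighbourhood on each axis
    line, which is what differentiating it along that axis requires. *)
Lemma open_along D i P :
  open D -> D P -> locally (coord i P) (fun s => D (along i P s)).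
Proof.
  intros HD HP; apply (continuous_along i P).
  rewrite along_coord; now apply HD.
Qed.

Lemma is_partial_ext D i g h P l :
  open D -> (forall Q, D Q -> g Q = h Q) -> D P ->
  is_partial i g P l -> is_partial i h P l.
Proof.
  intros HD E HP; apply is_derive_ext_loc.
  generalize (open_along D i P HD HP); apply filter_imp; auto.
Qed.

Lemma continuous_open_ext (D : point -> Prop) (g h : point -> R) P :
  open D -> (forall Q, D Q -> g Q = h Q) -> D P ->
  continuous h P -> continuous g P.
Proof.
  intros HD E HP; apply continuous_ext_loc.
  generalize (HD P HP); apply filter_imp; intros Q HQ; symmetry; auto.
Qed.

(** Candidate formulas for the partial derivatives prove regularity without
    rewriting under [Derive], whose value is meaningless until
    differentiability is known. *)
Lemma C1_of_partials D g (d : axis -> point -> R) :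
  open D -> (forall P, D P -> continuous g P) ->
  (forall i P, D P -> is_partial i g P (d i P) /\ continuous (d i) P) ->
  C1 D g.
Proof.
  intros HD Hc Hd; split; [exact Hc|]; intros i P HP.
  assert (E : forall Q, D Q -> partial i g Q = d i Q)
    by (intros Q HQ; apply partial_unique, Hd, HQ).
  split.
  - rewrite (E P HP); now apply Hd.
  - apply (continuous_open_ext D _ (d i)); trivial; now apply Hd.
Qed.

Lemma C1_ext D g h :
  open D -> (forall P, D P -> g P = h P) -> C1 D g -> C1 D h.
Proof.
  intros HD E [Hc Hd].
  apply (C1_of_partials D h (fun i => partial i g)); trivial.
  - intros P HP; apply (continuous_open_ext D _ g); auto.
    intros Q HQ; symmetry; auto.
  - intros i P HP; split; [|now apply Hd].
    apply (is_partial_ext D i g); trivial; now apply Hd.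
Qed.

Lemma continuous_Rmult (g h : point -> R) P :
  continuous g P -> continuous h P -> continuous (fun Q => g Q * h Q) P.
Proof. apply (continuous_mult (K := R_AbsRing)). Qed.

Lemma continuous_Rplus (g h : point -> R) P :
  continuous g P -> continuous h P -> continuous (fun Q => g Q + h Q) P.
Proof. apply (continuous_plus (V := R_NormedModule)). Qed.

Lemma continuous_Rminus (g h : point -> R) P :
  continuous g P -> continuous h P -> continuous (fun Q => g Q - h Q) P.
Proof. apply (continuous_minus (V := R_NormedModule)). Qed.

Lemma continuous_Rinv_fun (g : point -> R) P :
  continuous g P -> g P <> 0 -> continuous (fun Q => / g Q) P.
Proof.
  intros Hg H0; apply (continuous_comp g Rinv); trivial.
  now apply continuous_Rinv.
Qed.

Lemma C1_plus D g h :
  open D -> C1 D g -> C1 D h -> C1 D (fun P => g P + h P).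
Proof.
  intros HD [Hg Hg'] [Hh Hh'].
  apply (C1_of_partials D _ (fun i P => partial i g P + partial i h P)); trivial.
  - intros P HP; apply continuous_Rplus; auto.
  - intros i P HP; destruct (Hg' i P HP), (Hh' i P HP); split.
    + now apply is_partial_plus.
    + now apply continuous_Rplus.
Qed.

Lemma C1_minus D g h :
  open D -> C1 D g -> C1 D h -> C1 D (fun P => g P - h P).
Proof.
  intros HD [Hg Hg'] [Hh Hh'].
  apply (C1_of_partials D _ (fun i P => partial i g P - partial i h P)); trivial.
  - intros P HP; apply continuous_Rminus; auto.
  - intros i P HP; destruct (Hg' i P HP), (Hh' i P HP); split.
    + now apply is_partial_minus.
    + now apply continuous_Rminus.
Qed.

Lemma C1_mult D g h :
  open D -> C1 D g -> C1 D h -> C1 D (fun P => g P * h P).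
Proof.
  intros HD [Hg Hg'] [Hh Hh'].
  apply (C1_of_partials D _
           (fun i P => partial i g P * h P + g P * partial i h P)); trivial.
  - intros P HP; apply continuous_Rmult; auto.
  - intros i P HP; destruct (Hg' i P HP), (Hh' i P HP); split.
    + now apply is_partial_mult.
    + apply continuous_Rplus; apply continuous_Rmult; auto.
Qed.

Lemma C1_inv D g :
  open D -> C1 D g -> (forall P, D P -> g P <> 0) -> C1 D (fun P => / g P).
Proof.
  intros HD [Hg Hg'] H0.
  apply (C1_of_partials D _ (fun i P => - partial i g P / g P ^ 2)); trivial.
  - intros P HP; apply continuous_Rinv_fun; auto.
  - intros i P HP; destruct (Hg' i P HP); split.
    + apply is_partial_inv; auto.
    + apply continuous_Rmult.
      * now apply (continuous_opp (V := R_NormedModule)).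
      * apply continuous_Rinv_fun; [|apply pow_nonzero; auto].
        simpl; repeat apply continuous_Rmult; auto; apply continuous_const.
Qed.

(** Schwarz' theorem in the coordinate plane through [P] spanned by the axes [i]
    and [j], parametrised by [along i (along j P v) u]. *)
Lemma partial_comm D g i j P :
  open D -> C1 D g -> (forall k, C1 D (partial k g)) -> D P ->
  partial i (partial j g) P = partial j (partial i g) P.
Proof.
  intros HD Hg Hg' HP.
  assert (Hcont : forall k l, continuous (partial k (partial l g)) P)
    by (intros k l; now apply Hg').
  assert (Hloc : locally_2d
            (fun u v => D (along i (along j P v) u)) (coord i P) (coord j P)).
  { apply locally_2d_locally.
    apply (continuous_along2 i j P (coord i P, coord j P)); simpl.
    now rewrite !along_coord; apply HD. }
  assert (Hc2 : forall h : point -> R, continuous h P ->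
     continuity_2d_pt (fun u v => h (along i (along j P v) u))
       (coord i P) (coord j P)).
  { intros h Hh; apply continuity_2d_pt_filterlim.
    apply (continuous_comp
             (fun z : R * R => along i (along j P (snd z)) (fst z)) h).
    - apply continuous_along2.
    - simpl; now rewrite !along_coord. }
  pose proof (Schwarz (fun u v => g (along i (along j P v) u))
                (coord i P) (coord j P)) as S.
  pose proof (Hc2 _ (Hcont i j)) as Hij.
  pose proof (Hc2 _ (Hcont j i)) as Hji.
  destruct P as [[t x] y].
  destruct i, j; trivial; (apply S;
    (* Derivatives of the planar restriction are, by computation, partial
       derivatives of [g] at the corresponding point of the plane. *)
    [ revert Hloc;
      apply locally_2d_impl, locally_2d_forall; intros u v HQ;
      simpl in HQ;
      repeat split; eexists;
      first [ exact (proj1 (proj2 Hg axis_t _ HQ))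
            | exact (proj1 (proj2 Hg axis_x _ HQ))
            | exact (proj1 (proj2 Hg axis_y _ HQ))
            | exact (proj1 (proj2 (Hg' axis_t) axis_x _ HQ))
            | exact (proj1 (proj2 (Hg' axis_t) axis_y _ HQ))
            | exact (proj1 (proj2 (Hg' axis_x) axis_t _ HQ))
            | exact (proj1 (proj2 (Hg' axis_x) axis_y _ HQ))
            | exact (proj1 (proj2 (Hg' axis_y) axis_t _ HQ))
            | exact (proj1 (proj2 (Hg' axis_y) axis_x _ HQ)) ]
    | exact Hij
    | exact Hji ]).
Qed.

(** * Functions of the vorticity *)

(** The condition dg /\ dW = 0: where dW does not vanish, [g] is locally a
    function of [W].  Stated without division, it is visibly antisymmetric in
    the two axes and bilinear. *)
Definition function_of (D : point -> Prop) (W g : point -> R) : Prop :=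
  C1 D g /\
  forall i j P, D P ->
    partial i g P * partial j W P = partial j g P * partial i W P.

Lemma function_of_ext D W g h :
  open D -> (forall P, D P -> g P = h P) ->
  function_of D W g -> function_of D W h.
Proof.
  intros HD E [Hg Hw]; split; [now apply (C1_ext D g)|].
  assert (Ep : forall i P, D P -> partial i h P = partial i g P).
  { intros i P HP; apply partial_unique.
    apply (is_partial_ext D i g); trivial; now apply (proj2 Hg). }
  intros i j P HP; rewrite !Ep by trivial; now apply Hw.
Qed.

Lemma function_of_plus D W g h :
  open D -> function_of D W g -> function_of D W h ->
  function_of D W (fun P => g P + h P).
Proof.
  intros HD [Hg Hgw] [Hh Hhw]; split; [now apply C1_plus|].
  intros i j P HP.
  assert (E : forall k, partial k (fun Q => g Q + h Q) P
                        = partial k g P + partial k h P).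
  { intros k; apply partial_unique, is_partial_plus;
      [now apply (proj2 Hg) | now apply (proj2 Hh)]. }
  rewrite !E, !Rmult_plus_distr_r.
  now rewrite (Hgw i j P HP), (Hhw i j P HP).
Qed.

Lemma function_of_minus D W g h :
  open D -> function_of D W g -> function_of D W h ->
  function_of D W (fun P => g P - h P).
Proof.
  intros HD [Hg Hgw] [Hh Hhw]; split; [now apply C1_minus|].
  intros i j P HP.
  assert (E : forall k, partial k (fun Q => g Q - h Q) P
                        = partial k g P - partial k h P).
  { intros k; apply partial_unique, is_partial_minus;
      [now apply (proj2 Hg) | now apply (proj2 Hh)]. }
  rewrite !E, !Rmult_minus_distr_r.
  now rewrite (Hgw i j P HP), (Hhw i j P HP).
Qed.

Lemma function_of_mult D W g h :
  open D -> function_of D W g -> function_of D W h ->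
  function_of D W (fun P => g P * h P).
Proof.
  intros HD [Hg Hgw] [Hh Hhw]; split; [now apply C1_mult|].
  intros i j P HP.
  assert (E : forall k, partial k (fun Q => g Q * h Q) P
                        = partial k g P * h P + g P * partial k h P).
  { intros k; apply partial_unique, is_partial_mult;
      [now apply (proj2 Hg) | now apply (proj2 Hh)]. }
  rewrite !E.
  transitivity (h P * (partial i g P * partial j W P)
                + g P * (partial i h P * partial j W P)); [ring|].
  rewrite (Hgw i j P HP), (Hhw i j P HP); ring.
Qed.

Lemma function_of_inv D W g :
  open D -> function_of D W g -> (forall P, D P -> g P <> 0) ->
  function_of D W (fun P => / g P).
Proof.
  intros HD [Hg Hgw] H0; split; [now apply C1_inv|].
  intros i j P HP.
  assert (E : forall k, partial k (fun Q => / g Q) P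
                        = - partial k g P / g P ^ 2).
  { intros k; apply partial_unique, is_partial_inv; auto.
    now apply (proj2 Hg). }
  rewrite !E; unfold Rdiv.
  transitivity (- / g P ^ 2 * (partial i g P * partial j W P)); [ring|].
  rewrite (Hgw i j P HP); ring.
Qed.

(** If dg = a dW then 0 = d(dg) = da /\ dW, so the derivative [a] of [g] with
    respect to [W] is again a function of [W].  Any axis [k] along which [W] has
    no critical point computes [a]. *)
Lemma function_of_derivative D W g k :
  open D -> C1 D W -> (forall i, C1 D (partial i W)) ->
  (forall P, D P -> partial k W P <> 0) ->
  (forall i, C1 D (partial i g)) -> function_of D W g ->
  function_of D W (fun P => partial k g P * / partial k W P).
Proof.
  intros HD HW HW' H0 Hg' [Hg Hw].
  set (a := fun P => partial k g P * / partial k W P).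
  assert (Ha : C1 D a) by (apply C1_mult; trivial; now apply C1_inv).
  split; [exact Ha|].
  assert (E : forall i P, D P -> a P * partial i W P = partial i g P).
  { intros i P HP; unfold a.
    apply (Rmult_eq_reg_r (partial k W P)); [|now apply H0].
    rewrite (Hw i k P HP); field; now apply H0. }
  (* Differentiating dg = a dW once more; antisymmetrising in i and j kills the
     second derivatives of g and of W. *)
  assert (E2 : forall i j P, D P -> partial i (partial j g) P
      = partial i a P * partial j W P + a P * partial i (partial j W) P).
  { intros i j P HP; apply partial_unique.
    apply (is_partial_ext D i (fun Q => a Q * partial j W Q)); auto.
    apply is_partial_mult; [now apply (proj2 Ha) | now apply (proj2 (HW' j))]. }
  intros i j P HP.
  pose proof (partial_comm D g i j P HD Hg Hg' HP) as S.
  rewrite !E2, (partial_comm D W i j P HD HW HW' HP) in S by trivial.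
  lra.
Qed.

(** The spatial equation makes grad g proportional to grad W.  As [g] and [W] are
    transported by the same flow, the time derivatives have the same ratio. *)
Lemma lax_function_of D W Psi g :
  (forall P, D P -> dx W P <> 0) ->
  (forall P, D P -> dt W P + bracket Psi W P = 0) ->
  C1 D g ->
  (forall P, D P -> bracket W g P = 0 /\ dt g P + bracket Psi g P = 0) ->
  function_of D W g.
Proof.
  intros H0 HE Hg HL; split; [exact Hg|].
  assert (Hx : forall i P, D P ->
            partial i g P = dx g P / dx W P * partial i W P).
  { intros i P HP; specialize (H0 P HP).
    specialize (HE P HP); destruct (HL P HP) as [L1 L2].
    unfold bracket in *.
    assert (Ey : dy g P = dx g P / dx W P * dy W P).
    { apply (Rmult_eq_reg_l (dx W P)); trivial; field_simplify; trivial; lra. }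
    destruct i; simpl; trivial; [|now field].
    assert (Et : dt W P = dy Psi P * dx W P - dx Psi P * dy W P) by lra.
    rewrite Et.
    replace (dt g P) with (dy Psi P * dx g P - dx Psi P * dy g P) by lra.
    rewrite Ey; now field. }
  intros i j P HP; rewrite (Hx i P HP), (Hx j P HP); ring.
Qed.

Lemma lax_equations_iff W Psi p P :
  (bracketC W p P = RtoC 0 /\ (dtC p P + bracketC Psi p P)%C = RtoC 0) <->
  (forall h, h = re_part p \/ h = im_part p ->
     bracket W h P = 0 /\ dt h P + bracket Psi h P = 0).
Proof.
  unfold bracketC, dtC, dxC, dyC, RtoC, Cminus, Cplus, Cmult, Copp; simpl.
  split.
  - intros [E1 E2]; injection E1 as A1 A2; injection E2 as B1 B2.
    intros h [-> | ->]; unfold bracket; split; lra.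
  - intros H; destruct (H _ (or_introl eq_refl)) as [A1 B1].
    destruct (H _ (or_intror eq_refl)) as [A2 B2].
    unfold bracket in *; split; f_equal; lra.
Qed.

Lemma lax_parts_function_of D W Psi p h :
  (forall P, D P -> dx W P <> 0) ->
  (forall P, D P -> dt W P + bracket Psi W P = 0) ->
  lax_solution D W Psi p -> h = re_part p \/ h = im_part p ->
  function_of D W h.
Proof.
  intros H0 HE [[Hr Hi] HL] Hh.
  apply (lax_function_of D W Psi); trivial.
  - destruct Hh as [-> | ->]; eapply Ck_C1; eassumption.
  - intros P HP; exact (proj1 (lax_equations_iff W Psi p P) (HL P HP) h Hh).
Qed.

(** Real and imaginary parts of p_x / W_x - (m + i n) p, where m + i n is
    (f_x / W_x) times the conjugate of f divided by |f|^2: this displays them as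
    rational expressions in functions of [W]. *)
Lemma gauge_parts D W f p :
  (forall P, D P -> dx W P <> 0) -> (forall P, D P -> f P <> RtoC 0) ->
  let u := re_part p in let v := im_part p in
  let r := re_part f in let s := im_part f in
  let slope g P := dx g P * / dx W P in
  let N P := / (r P * r P + s P * s P) in
  let m P := (slope r P * r P + slope s P * s P) * N P in
  let n P := (slope s P * r P - slope r P * s P) * N P in
  forall P, D P ->
    r P * r P + s P * s P <> 0 /\
    slope u P - (m P * u P - n P * v P) = re_part (gauge W f p) P /\
    slope v P - (m P * v P + n P * u P) = im_part (gauge W f p) P.
Proof.
  intros H0 Hf u v r s slope N m n P HP.
  assert (Hn : r P * r P + s P * s P <> 0).
  { specialize (Hf P HP); intros E; apply Hf.
    assert (r P = 0) by nra; assert (s P = 0) by nra.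
    unfold r, s, re_part, im_part in *.
    destruct (f P) as [a b]; simpl in *; now subst. }
  specialize (H0 P HP).
  split; [exact Hn|].
  unfold m, n, N, slope, re_part, im_part, gauge, dx_ln, dxC, Re, Im in *.
  fold u v r s.
  replace (f P) with (r P, s P)
    by (unfold r, s, re_part, im_part; now destruct (f P)).
  replace (p P) with (u P, v P)
    by (unfold u, v, re_part, im_part; now destruct (p P)).
  unfold Cdiv, Cinv, Cminus, Cplus, Copp, Cmult, RtoC; simpl.
  unfold u, v, r, s, re_part, im_part, Re, Im in *.
  split; field; repeat split; trivial; nra.
Qed.

Lemma gauge_parts_function_of D W f p h :
  open D -> C1 D W -> (forall i, C1 D (partial i W)) ->
  (forall P, D P -> dx W P <> 0) -> (forall P, D P -> f P <> RtoC 0) ->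
  (forall q g i, q = f \/ q = p -> g = re_part q \/ g = im_part q ->
     function_of D W g /\ C1 D (partial i g)) ->
  h = re_part (gauge W f p) \/ h = im_part (gauge W f p) ->
  function_of D W h.
Proof.
  intros HD HW HW' H0 Hf Hfp Hh.
  pose proof (gauge_parts D W f p H0 Hf) as HG; cbv zeta in HG.
  assert (B : forall q g, q = f \/ q = p -> g = re_part q \/ g = im_part q ->
            function_of D W g) by (intros; now apply (Hfp q g axis_x)).
  assert (S : forall q g, q = f \/ q = p -> g = re_part q \/ g = im_part q ->
            function_of D W (fun P => dx g P * / dx W P)).
  { intros q g Hq Hg; apply (function_of_derivative D W g axis_x); trivial.
    - intros i; now apply (Hfp q g i).
    - now apply (B q). }
  pose proof (B f _ (or_introl eq_refl) (or_introl eq_refl)) as Br.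
  pose proof (B f _ (or_introl eq_refl) (or_intror eq_refl)) as Bs.
  pose proof (B p _ (or_intror eq_refl) (or_introl eq_refl)) as Bu.
  pose proof (B p _ (or_intror eq_refl) (or_intror eq_refl)) as Bv.
  pose proof (S f _ (or_introl eq_refl) (or_introl eq_refl)) as Sr.
  pose proof (S f _ (or_introl eq_refl) (or_intror eq_refl)) as Ss.
  pose proof (S p _ (or_intror eq_refl) (or_introl eq_refl)) as Su.
  pose proof (S p _ (or_intror eq_refl) (or_intror eq_refl)) as Sv.
  pose proof (fun g h => function_of_plus D W g h HD) as Add.
  pose proof (fun g h => function_of_minus D W g h HD) as Sub.
  pose proof (fun g h => function_of_mult D W g h HD) as Mul.
  pose proof (function_of_inv D W _ HD
                (Add _ _ (Mul _ _ Br Br) (Mul _ _ Bs Bs))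
                (fun P HP => proj1 (HG P HP))) as BN.
  pose proof (Mul _ _ (Add _ _ (Mul _ _ Sr Br) (Mul _ _ Ss Bs)) BN) as Bm.
  pose proof (Mul _ _ (Sub _ _ (Mul _ _ Ss Br) (Mul _ _ Sr Bs)) BN) as Bn.
  destruct Hh as [-> | ->].
  - exact (function_of_ext D W _ _ HD (fun P HP => proj1 (proj2 (HG P HP)))
             (Sub _ _ Su (Sub _ _ (Mul _ _ Bm Bu) (Mul _ _ Bn Bv)))).
  - exact (function_of_ext D W _ _ HD (fun P HP => proj2 (proj2 (HG P HP)))
             (Sub _ _ Sv (Add _ _ (Mul _ _ Bm Bv) (Mul _ _ Bn Bu)))).
Qed.

(** * The transformed potentials *)

(** With grad (laplacian F) = g grad W, the second constraint is
    (1 + g) {W, F} = 0.  Were {W, F} nonzero at a point, it would be so on an open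
    set, on which 1 + g = 0 and W + laplacian F is spatially constant. *)
Lemma bracket_zero_of_nondegenerate D W F :
  open D -> C1 D W -> C1 D F -> C1 D (laplacian F) ->
  (forall P, D P -> dx W P <> 0) ->
  (forall P, D P -> bracket W (laplacian F) P = 0) ->
  (forall P, D P -> bracket (new_Omega W F) F P = 0) ->
  nondegenerate D (new_Omega W F) ->
  forall P, D P -> bracket W F P = 0.
Proof.
  intros HD HW HF HL H0 H1 H2 Hnd P HP.
  destruct (Req_dec (bracket W F P) 0) as [E | E]; [exact E | exfalso].
  (* Nondegeneracy yields a point where both {W, F} and the new gradient are
     nonzero. *)
  destruct (Hnd (fun Q => D Q /\ bracket W F Q <> 0)) as [Q [[HQ HB] Hgrad]].
  - intros Q [HQ HB]; apply filter_and; [now apply HD|].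
    assert (Hc : continuous (bracket W F) Q).
    { apply continuous_Rminus; apply continuous_Rmult.
      - exact (proj2 (proj2 HW axis_x Q HQ)).
      - exact (proj2 (proj2 HF axis_y Q HQ)).
      - exact (proj2 (proj2 HW axis_y Q HQ)).
      - exact (proj2 (proj2 HF axis_x Q HQ)). }
    apply (Hc (fun z => z <> 0)), open_neq, HB.
  - now intros Q [HQ _].
  - now exists P.
  - specialize (H0 Q HQ); specialize (H1 Q HQ); specialize (H2 Q HQ).
    assert (E' : forall i, partial i (new_Omega W F) Q
                      = partial i W Q + partial i (laplacian F) Q).
    { intros i; apply partial_unique, is_partial_plus;
        [now apply (proj2 HW) | now apply (proj2 HL)]. }
    unfold bracket in *.
    pose proof (E' axis_x) as Ex; pose proof (E' axis_y) as Ey; simpl in Ex, Ey.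
    rewrite Ex, Ey in *.
    set (g := dx (laplacian F) Q / dx W Q).
    assert (Lx : dx (laplacian F) Q = g * dx W Q) by (unfold g; now field).
    assert (Ly : dy (laplacian F) Q = g * dy W Q).
    { apply (Rmult_eq_reg_l (dx W Q)); trivial.
      transitivity (dy W Q * dx (laplacian F) Q); [lra | rewrite Lx; ring]. }
    rewrite Lx, Ly in *.
    assert (K : (1 + g) * (dx W Q * dy F Q - dy W Q * dx F Q) = 0) by lra.
    apply Rmult_integral in K; destruct K as [K | K]; [|lra].
    replace g with (-1) in Hgrad by lra; destruct Hgrad; lra.
Qed.

(** Both equations are linear in dh = e dW, so they reduce to the case h = W:
    {W + laplacian F, W} = 0, and {F, W} = 0 leaves the Euler equation. *)
Lemma function_of_lax D W Psi F h :
  C1 D W -> C1 D Psi -> C1 D F -> C1 D (laplacian F) ->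
  (forall P, D P -> dx W P <> 0) ->
  (forall P, D P -> dt W P + bracket Psi W P = 0) ->
  (forall P, D P -> bracket W (laplacian F) P = 0) ->
  (forall P, D P -> bracket W F P = 0) ->
  function_of D W h ->
  forall P, D P -> bracket (new_Omega W F) h P = 0 /\
                   dt h P + bracket (new_Psi Psi F) h P = 0.
Proof.
  intros HW HPsi HF HL H0 HE H1 H2 [Hh Hw] P HP.
  assert (EW : forall i, partial i (new_Omega W F) P
                    = partial i W P + partial i (laplacian F) P).
  { intros i; apply partial_unique, is_partial_plus;
      [now apply (proj2 HW) | now apply (proj2 HL)]. }
  assert (EP : forall i, partial i (new_Psi Psi F) P
                    = partial i Psi P + partial i F P).
  { intros i; apply partial_unique, is_partial_plus;
      [now apply (proj2 HPsi) | now apply (proj2 HF)]. }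
  pose proof (EW axis_x) as Wx; pose proof (EW axis_y) as Wy.
  pose proof (EP axis_x) as Px; pose proof (EP axis_y) as Py.
  specialize (H0 P HP); specialize (H1 P HP); specialize (H2 P HP).
  specialize (HE P HP).
  set (e := dx h P / dx W P).
  assert (Eh : forall i, partial i h P = e * partial i W P).
  { intros i; apply (Rmult_eq_reg_r (dx W P)); trivial.
    rewrite (Hw i axis_x P HP : partial i h P * dx W P = _).
    unfold e; simpl; now field. }
  pose proof (Eh axis_t) as ht; pose proof (Eh axis_x) as hx.
  pose proof (Eh axis_y) as hy; simpl in *.
  unfold bracket in *; rewrite Wx, Wy, Px, Py, ht, hx, hy.
  split.
  - transitivity (- e * (dx W P * dy (laplacian F) P
                         - dy W P * dx (laplacian F) P)); [ring|].
    rewrite H1; ring.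
  - transitivity (e * (dt W P + (dx Psi P * dy W P - dy Psi P * dx W P))
                  - e * (dx W P * dy F P - dy W P * dx F P)); [ring|].
    rewrite HE, H2; ring.
Qed.

Theorem theorem5p1 (D : R * R * R -> Prop) (Omega Psi F : R * R * R -> R)
    (f p : R * R * R -> C)
    (hD : open D)
    (hOmega : Ck 2 D Omega) (hPsi : Ck 2 D Psi)
    (heuler : euler_solution D Omega Psi)
    (hf : CkC 2 D f) (hfS : lax_solution D Omega Psi f)
    (hp : CkC 2 D p) (hpS : lax_solution D Omega Psi p)
    (hOmegax : forall P, D P -> dx Omega P <> 0)
    (hf0 : forall P, D P -> f P <> RtoC 0)
    (hF : Ck 3 D F)
    (hF1 : forall P, D P -> bracket Omega (laplacian F) P = 0)
    (hF2 : forall P, D P -> bracket (new_Omega Omega F) F P = 0)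
    (hnondeg : nondegenerate D (new_Omega Omega F)) :
  lax_solution D (new_Omega Omega F) (new_Psi Psi F) (gauge Omega f p).
Proof.
  assert (HE : forall P, D P -> dt Omega P + bracket Psi Omega P = 0)
    by (intros P HP; apply (heuler P HP)).
  assert (HW : C1 D Omega) by now apply (Ck_C1 1).
  assert (HW' : forall i, C1 D (partial i Omega))
    by (intros i; now apply (Ck_C1 0), Ck_partial).
  assert (HPsi : C1 D Psi) by now apply (Ck_C1 1).
  assert (HF : C1 D F) by now apply (Ck_C1 2).
  assert (HL : C1 D (laplacian F)).
  { apply (C1_plus D (dx (dx F)) (dy (dy F))); trivial; apply (Ck_C1 0).
    - now apply (Ck_partial 1 D _ axis_x), (Ck_partial 2 D _ axis_x).
    - now apply (Ck_partial 1 D _ axis_y), (Ck_partial 2 D _ axis_y). }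
  assert (HB := bracket_zero_of_nondegenerate
                  D Omega F hD HW HF HL hOmegax hF1 hF2 hnondeg).
  assert (HG : forall h,
            h = re_part (gauge Omega f p) \/ h = im_part (gauge Omega f p) ->
            function_of D Omega h).
  { intros h; apply (gauge_parts_function_of D Omega f p); trivial.
    intros q g i Hq Hg; split.
    - apply (lax_parts_function_of D Omega Psi q); trivial.
      now destruct Hq as [-> | ->].
    - apply (Ck_C1 0), Ck_partial.
      destruct hf, hp, Hq as [-> | ->], Hg as [-> | ->]; assumption. }
  split.
  - split; apply C1_Ck, HG; [now left | now right].
  - intros P HP; apply lax_equations_iff; intros h Hh.
    apply (function_of_lax D Omega Psi F); auto.
Qed.
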